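(* Let $\Omega$ be a convex domain in $\mathbf{R}^N$. Let $F_1$ and $F_2$ be admissible on an open interval $I\subset\mathbf{R}$ such that $F_1$-concavity is nontrivial in $\Omega$. Then $\mathcal{C}_\Omega[F_1]=\mathcal{C}_\Omega[F_2]$ if and only if there exists a pair $(A,B)\in(0,\infty)\times\mathbf{R}$ such that $$F_1(\tau)=A F_2(\tau)+B\quad\text{for all }\tau\in I.$$
   Context: A convex domain is a nonempty open convex set in $\mathbf{R}^N$, $N\ge 1$; intervals have nonempty interior. A function $F:I\to\mathbf{R}\cup\{-\infty\}$ is called admissible on $I$ if $F$ is strictly increasing on $I$ and continuous on $\mathrm{Int}\,I$ (for open $I$, such an $F$ is automatically real-valued). Let $\mathcal{A}_\Omega(I)$ be the set of functions $f$ on $\Omega$ with $f(x)\in I$ for all $x\in\Omega$. A function $f\in\mathcal{A}_\Omega(I)$ is called $F$-concave in $\Omega$ if $F(f((1-\mu)x+\mu y))\ge(1-\mu)F(f(x))+\mu F(f(y))$ for all $x,y\in\Omega$ and $\mu\in[0,1]$. $\mathcal{C}_\Omega[F]$ denotes the set of $F$-concave functions in $\Omega$. $F$-concavity is called trivial in $\Omega$ if $\mathcal{C}_\Omega[F]$ equals the set of constant functions in $\mathcal{A}_\Omega(I)$, and nontrivial otherwise. *)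

(* Defs.v *)
From mathcomp Require Import all_boot all_order all_algebra.
From mathcomp Require Import all_classical all_reals all_analysis.

Set Implicit Arguments.
Unset Strict Implicit.
Unset Printing Implicit Defensive.

Import Order.TTheory GRing.Theory Num.Theory.
Import numFieldNormedType.Exports.

Local Open Scope classical_set_scope.
Local Open Scope ring_scope.

Definition convex_domain (R : realType) (N : nat) (Omega : set 'rV[R]_N) : Prop :=
  [/\ Omega !=set0, open Omega & convex_set Omega].

Definition nondegenerate_interval (R : realType) (I : set R) : Prop :=
  is_interval I /\ I° !=set0.

(* A function I -> R \cup {-oo} is a total function into \bar R of which only
   the values on I matter; +oo is excluded there. *)
Definition admissible (R : realType) (I : set R) (F : R -> \bar R) : Prop :=
  [/\ forall t, I t -> F t != +oo%E,
      forall s t, I s -> I t -> s < t -> (F s < F t)%E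
    & forall t, I° t -> {for t, continuous F}].

(* Functions on Omega are likewise total functions constrained only on Omega:
   membership in each of the sets below depends only on f restricted to Omega. *)
Definition functions_into (R : realType) (N : nat) (Omega : set 'rV[R]_N)
    (I : set R) : set ('rV[R]_N -> R) :=
  [set f | forall x, Omega x -> I (f x)].

Definition constant_functions_into (R : realType) (N : nat)
    (Omega : set 'rV[R]_N) (I : set R) : set ('rV[R]_N -> R) :=
  [set f | functions_into Omega I f /\
           exists c : R, forall x, Omega x -> f x = c].

Definition F_concave (R : realType) (N : nat) (Omega : set 'rV[R]_N)
    (F : R -> \bar R) (f : 'rV[R]_N -> R) : Prop :=
  forall (x y : 'rV[R]_N) (mu : R), Omega x -> Omega y -> 0 <= mu <= 1 ->
    ((1 - mu)%R%:E * F (f x) + mu%:E * F (f y)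
       <= F (f ((1 - mu) *: x + mu *: y)%R))%E.

Definition F_concave_functions (R : realType) (N : nat) (Omega : set 'rV[R]_N)
    (I : set R) (F : R -> \bar R) : set ('rV[R]_N -> R) :=
  [set f | functions_into Omega I f /\ F_concave Omega F f].

Definition trivial_concavity (R : realType) (N : nat) (Omega : set 'rV[R]_N)
    (I : set R) (F : R -> \bar R) : Prop :=
  F_concave_functions Omega I F = constant_functions_into Omega I.

(* Main.v *)
(** [F1] and [F2] are real-valued on the open interval [I], so equality of the
    two classes says that [F1 \o F2^-1] and its inverse both preserve concavity
    of functions on [Omega].  Given [s] and [t] in [I], there is an [F2]-concave
    function [f] such that [F2 \o f] is affine on a segment of [Omega] along which
    [f] takes all the values between [s] and [t]; hence [F1 \o F2^-1] is concave,
    by symmetry also convex, thus affine.  If [Omega] is a proper subset, [F2 \o f]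
    is an affine image of one minus the Minkowski gauge of [Omega], which is
    bounded and affine along rays from the centre.  If [Omega] is the whole space, it is a
    truncated linear form; its values may be taken in [F2 @` I] because a nonconstant concave function
    on the whole space is unbounded below, so that nontriviality forces [F2] to be
    unbounded below on [I]. *)
Require Import Defs.
From mathcomp Require Import all_boot all_order all_algebra.
From mathcomp Require Import all_classical all_reals all_analysis.
From mathcomp Require Import ring lra.
Set Implicit Arguments.
Unset Strict Implicit.
Unset Printing Implicit Defensive.

Import Order.TTheory GRing.Theory Num.Theory.
Import numFieldNormedType.Exports.
Local Open Scope classical_set_scope.
Local Open Scope ring_scope.

(** * Concavity, convex combinations and small shifts in open sets *)

Definition concave_on (R : realType) (V : lmodType R) (D : set V)
    (g : V -> R) : Prop :=
  forall (x y : V) (mu : R), D x -> D y -> 0 <= mu <= 1 ->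
    (1 - mu) * g x + mu * g y <= g ((1 - mu) *: x + mu *: y).

Lemma convex_set_comb (R : realType) (V : lmodType R) (D : set V) (x y : V)
    (mu : R) : convex_set D -> D x -> D y -> 0 <= mu <= 1 ->
  D ((1 - mu) *: x + mu *: y).
Proof.
move=> cD Dx Dy mu01.
have := cD y x (Itv01 (andP mu01).1 (andP mu01).2); rewrite !inE => /(_ Dy Dx).
by rewrite [X in D X -> _]addrC.
Qed.

Lemma open_shift (R : realType) (V : normedModType R) (D : set V) (x d : V) :
  open D -> D x -> exists2 e : R, 0 < e & D (x + e *: d).
Proof.
move=> oD Dx.
have : \forall e \near (0 : R)^'+, D (x + e *: d).
  have H : x + e *: d @[e --> (0 : R)^'+] --> x + 0 *: d.
    apply: cvgD; first exact: cvg_cst.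
    by apply: cvgZr_tmp; apply: cvg_at_right_filter; exact: cvg_id.
  rewrite scale0r addr0 in H.
  by apply: H; exact: open_nbhs_nbhs.
move=> H; near (0 : R)^'+ => e.
exists e; first by near: e; exact: nbhs_right_gt.
by near: e.
Unshelve. all: by end_near. Qed.

(** * The Minkowski gauge of an open convex set *)

Section RadialFunction.
Variables (R : realType) (N : nat) (D : set 'rV[R]_N) (x0 : 'rV[R]_N).
Hypotheses (cD : convex_set D) (oD : open D) (Dx0 : D x0).

(** [1 - s] is the ratio of a homothety centred at [x0] whose image of [D] contains [x]. *)
Definition radial_levels (x : 'rV[R]_N) : set R :=
  [set s | 0 <= s < 1 /\ exists2 y, D y & x = s *: x0 + (1 - s) *: y].

(* [1 - radial] is the Minkowski gauge of [D] centred at [x0]. *)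
Definition radial (x : 'rV[R]_N) : R := sup (radial_levels x).

Lemma radial_levels0 (x : 'rV[R]_N) : D x -> radial_levels x 0.
Proof.
move=> Dx; split; first by rewrite lexx ltr01.
by exists x => //; rewrite scale0r add0r subr0 scale1r.
Qed.

Lemma radial_ubound (x : 'rV[R]_N) : ubound (radial_levels x) 1.
Proof. by move=> s [/andP[_ /ltW]]. Qed.

Lemma has_sup_radial (x : 'rV[R]_N) : D x -> has_sup (radial_levels x).
Proof.
move=> Dx; split; first by exists 0; exact: radial_levels0.
by exists 1; exact: radial_ubound.
Qed.

Lemma le_radial (x : 'rV[R]_N) (s : R) : radial_levels x s -> s <= radial x.
Proof.
by move=> xs; apply: ub_le_sup => //; exists 1; exact: radial_ubound.
Qed.

Lemma radial_le1 (x : 'rV[R]_N) : D x -> radial x <= 1.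
Proof.
by move=> Dx; apply: ge_sup; [case: (has_sup_radial Dx)|exact: radial_ubound].
Qed.

(** By openness [x] can be pushed slightly away from [x0] inside [D], which leaves positive weight
    on [x0]. *)
Lemma radial_gt0 (x : 'rV[R]_N) : D x -> 0 < radial x.
Proof.
move=> Dx; have [e e0 De] := open_shift (x - x0) oD Dx.
have e1 : 0 < 1 + e by lra.
apply: (@lt_le_trans _ _ (e / (1 + e))); first exact: divr_gt0.
apply: le_radial; split.
  by rewrite divr_ge0 ?ltW//= ltr_pdivrMr// mul1r ltrDr ltr01.
exists (x + e *: (x - x0)) => //.
by apply/rowP => i; rewrite !mxE; field; lra.
Qed.

Lemma radial_levels_comb (x y : 'rV[R]_N) (s t mu : R) : 0 <= mu <= 1 ->
  radial_levels x s -> radial_levels y t ->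
  radial_levels ((1 - mu) *: x + mu *: y) ((1 - mu) * s + mu * t).
Proof.
move=> mu01 [s01 [a Da ->]] [t01 [b Db ->]].
set r := (1 - mu) * s + mu * t.
have r0 : 0 <= r < 1.
  move: mu01 s01 t01 => /andP[mu0 mu1] /andP[s0 s1] /andP[t0 t1].
  apply/andP; split; first by rewrite addr_ge0 ?mulr_ge0 ?subr_ge0.
  have [mu_lt1|mu_ge1] := ltP mu 1; last first.
    have muE : mu = 1 by lra.
    by rewrite /r muE; lra.
  have : 0 < (1 - mu) * (1 - s) by rewrite mulr_gt0 ?subr_gt0.
  have : 0 <= mu * (1 - t) by apply: mulr_ge0 => //; lra.
  by rewrite /r; lra.
have r1 : 0 < 1 - r by lra.
split => //.
(* Relative weight of [b] once the total weight [r] of [x0] is split off. *)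
pose l := mu * (1 - t) / (1 - r).
have l01 : 0 <= l <= 1.
  by rewrite /l divr_ge0 ?ler_pdivrMr//= /r; nra.
exists ((1 - l) *: a + l *: b); first exact: convex_set_comb.
by apply/rowP => i; rewrite !mxE /l /r; field; rewrite -/r; lra.
Qed.

(** Nearly optimal levels at [x] and [y] combine into a level at the intermediate point. *)
Lemma radial_concave : concave_on D radial.
Proof.
move=> x y mu Dx Dy mu01; apply/ler_addgt0Pr => e e0.
have [s xs sx] := sup_adherent e0 (has_sup_radial Dx).
have [t yt ty] := sup_adherent e0 (has_sup_radial Dy).
have := le_radial (radial_levels_comb mu01 xs yt).
rewrite -/(radial x) in sx; rewrite -/(radial y) in ty; nra.
Qed.

(* Scaled so that [x0 + e] is where the ray from [x0] through [z] leaves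
   [D]; the gauge is linear along that ray. *)
Lemma radial_affine_ray (z : 'rV[R]_N) : ~ D z ->
  exists e : 'rV[R]_N, forall t : R, 0 <= t < 1 ->
    D (x0 + t *: e) /\ radial (x0 + t *: e) = 1 - t.
Proof.
move=> Dz; pose d := z - x0.
pose S := [set t : R | 0 <= t /\ D (x0 + t *: d)].
have starD (s t : R) : 0 <= s <= t -> D (x0 + t *: d) -> D (x0 + s *: d).
  move=> st Dt; have [t0|t0] := leP t 0.
    by have -> : s = t by lra.
  have -> : x0 + s *: d = (1 - s / t) *: x0 + (s / t) *: (x0 + t *: d).
    by apply/rowP => i; rewrite !mxE; field; lra.
  apply: convex_set_comb => //.
  by rewrite divr_ge0 ?ler_pdivrMr ?mul1r//=; lra.
have S1 : ubound S 1.
  move=> t [t0 Dt]; rewrite leNgt; apply/negP => t1; apply: Dz.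
  have -> : z = x0 + 1 *: d by rewrite scale1r /d addrC subrK.
  by apply: starD Dt; lra.
have supS : has_sup S.
  split; last by exists 1.
  by exists 0; split => //; rewrite scale0r addr0.
have T0 : 0 < sup S.
  have [e e0 De] := open_shift d oD Dx0.
  apply: (lt_le_trans e0); apply: ub_le_sup; first by exists 1.
  split; [exact: ltW|exact: De].
set T := sup S in T0.
(* The supremum [T] need not be attained, but any parameter below it is dominated by an element of
   [S]. *)
have rayD (t : R) : 0 <= t < 1 -> D (x0 + t *: (T *: d)).
  move=> t01; have TT : 0 < T - t * T by nra.
  have [s [s0 Ds]] := sup_adherent TT supS; rewrite -/T => st.
  by rewrite scalerA; apply: starD Ds; nra.
exists (T *: d) => t t01; split; first exact: rayD.
apply/eqP; rewrite eq_le; apply/andP; split.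
  apply: ge_sup; first by case: (has_sup_radial (rayD t t01)).
  move=> s [s01 [y Dy xy]].
  have s1 : 0 < 1 - s by lra.
  (* The witness of a level [s] lies on the same ray, so its parameter is at most [T], which gives
     [s <= 1 - t]. *)
  have yE : y = x0 + (t * T / (1 - s)) *: d.
    have -> : y = (1 - s)^-1 *: (x0 + t *: (T *: d) - s *: x0).
      by rewrite xy; apply/rowP => i; rewrite !mxE; field; lra.
    by apply/rowP => i; rewrite !mxE; field; lra.
  have : S (t * T / (1 - s)).
    split; last by rewrite -yE.
    by apply: divr_ge0; [apply: mulr_ge0|]; lra.
  move=> /(ub_le_sup (ex_intro _ _ S1)); rewrite -/T ler_pdivrMr//; nra.
rewrite leNgt; apply/negP => h1.
set h := radial _ in h1.
have h0 : 0 <= h by apply: le_radial; apply: radial_levels0; exact: rayD.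
(* Were [h] below [1 - t], their midpoint would be a level exceeding the supremum. *)
have : (h + (1 - t)) / 2 <= h.
  apply: le_radial; split; first by lra.
  set m := (h + (1 - t)) / 2.
  have m1 : 0 < 1 - m by rewrite /m; lra.
  exists (x0 + (t / (1 - m)) *: (T *: d)).
    apply: rayD; rewrite divr_ge0 ?ltr_pdivrMr//= /m; lra.
  by apply/rowP => i; rewrite !mxE; field; lra.
lra.
Qed.

End RadialFunction.

Lemma concave_with_affine_ray (R : realType) (N : nat) (D : set 'rV[R]_N) :
  (0 < N)%N -> convex_domain D ->
  exists (w : 'rV[R]_N -> R) (x e : 'rV[R]_N),
  [/\ concave_on D w, forall y, D y -> w y <= 1,
      D = setT \/ (forall y, D y -> 0 < w y)
    & forall t, 0 <= t < 1 -> D (x + t *: e) /\ w (x + t *: e) = 1 - t].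
Proof.
case: N D => // N D _ [[x0 Dx0] oD cD].
have [DT|/existsNP[z Dz]] := pselect (forall y, D y).
  (* Truncation gives the bound 1 and is inactive on the ray from 0 along the first basis vector. *)
  exists (fun y => Num.min 1 (1 - y 0 0)), 0, (delta_mx 0 0); split.
  - move=> x y mu _ _ mu01; rewrite !mxE.
    by rewrite /Num.min; do 3! case: ifPn; rewrite -?leNgt => *; nra.
  - by move=> y _; rewrite ge_min lexx.
  - by left; rewrite -subTset => y _; exact: DT.
  - move=> t /andP[t0 _]; split; first exact: DT.
    by rewrite !mxE !eqxx mulr1 add0r min_r// gerBl.
have [e eP] := radial_affine_ray cD oD Dx0 Dz.
exists (radial D x0), x0, e; split => //.
- exact: radial_concave.
- by move=> y; exact: radial_le1.
- by right => y; exact: radial_gt0.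
Qed.

(** Extending the segment from [x] to [y] beyond [y] makes [y] a convex combination, so [v]
    decreases at least linearly there. *)
Lemma concave_unbounded_below (R : realType) (V : lmodType R) (v : V -> R)
    (x y : V) : concave_on setT v -> v y < v x ->
  forall M : R, exists z, v z <= M.
Proof.
(* Chosen so that the linear bound [v y - k * (v x - v y)] is at most [M]. *)
move=> cv yx M; pose k := Num.max 0 ((v y - M) / (v x - v y)).
have k0 : 0 <= k by rewrite le_max lexx.
have kM : v y - M <= k * (v x - v y).
  by rewrite -ler_pdivrMr ?subr_gt0// le_max lexx orbT.
exists (y + k *: (y - x)).
have k1 : 0 < 1 + k by lra.
have mu01 : 0 <= (1 + k)^-1 <= 1.
  by rewrite invr_ge0 ltW//= invf_le1// lerDl.
have := cv x (y + k *: (y - x)) _ Logic.I Logic.I mu01.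
have -> : (1 - (1 + k)^-1) *: x + (1 + k)^-1 *: (y + k *: (y - x)) = y.
  have -> : 1 - (1 + k)^-1 = (1 + k)^-1 * k by field; lra.
  rewrite -scalerA -scalerDr scalerBr addrCA subrKC.
  by rewrite -{1}[y]scale1r -scalerDl scalerA mulVf ?scale1r//; lra.
set vz := v (y + _) => H.
have : (1 + k) * ((1 - (1 + k)^-1) * v x + (1 + k)^-1 * vz) <= (1 + k) * v y.
  by rewrite ler_pM2l.
have -> : (1 + k) * ((1 - (1 + k)^-1) * v x + (1 + k)^-1 * vz) = k * v x + vz.
  by field; lra.
nra.
Qed.

(** * Comparing weighted means of two increasing functions *)

Section Transfer.
Variables (R : realType) (N : nat) (D : set 'rV[R]_N) (I : set R).
Hypotheses (N0 : (0 < N)%N) (dD : convex_domain D).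
Hypotheses (iI : is_interval I) (oI : open I).

Lemma interval_IVT (G : R -> R) (s t v : R) :
  (forall t, I t -> {for t, continuous G}) ->
  I s -> I t -> s <= t -> G s <= v <= G t -> exists2 r, I r & G r = v.
Proof.
move=> cG Is It st /andP[sv vt].
have sub r : s <= r <= t -> I r by exact: iI.
have [||r rst rv] := @IVT R G s t v st.
- apply: continuous_in_subspaceT => r; rewrite inE/= in_itv/= => /sub.
  exact: cG.
- by rewrite ge_min sv le_max vt orbT.
- by exists r => //; apply: sub; move: rst; rewrite in_itv.
Qed.

(* Compose [w] of [concave_with_affine_ray] with the affine map sending its
   range into [G2 @` I]: along the ray, the resulting [G2]-concave function
   passes through [s], [t] and [r]. *)
Lemma concavity_transfer (G1 G2 : R -> R) :
  {in I &, {homo G2 : s t / s < t}} ->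
  (forall t, I t -> {for t, continuous G2}) ->
  (D = setT -> forall M : R, exists2 s, I s & G2 s <= M) ->
  (forall f, (forall x, D x -> I (f x)) -> concave_on D (G2 \o f) ->
     concave_on D (G1 \o f)) ->
  forall s t r mu : R, I s -> I t -> I r -> 0 <= mu <= 1 ->
    G2 r = (1 - mu) * G2 s + mu * G2 t ->
    (1 - mu) * G1 s + mu * G1 t <= G1 r.
Proof.
move=> mG cG unbG sub s t r mu Is It Ir mu01 rE.
have mG_lt a b : I a -> I b -> a < b -> G2 a < G2 b.
  by move=> Ia Ib; apply: mG; rewrite inE.
have mG_le a b : I a -> I b -> a <= b -> G2 a <= G2 b.
  by move=> Ia Ib; rewrite le_eqVlt => /orP[/eqP->//|/mG_lt H]; exact/ltW/H.
have injG a b : I a -> I b -> G2 a = G2 b -> a = b.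
  move=> Ia Ib ab; case: (ltgtP a b) => // lt.
    by have := mG_lt _ _ Ia Ib lt; rewrite ab ltxx.
  by have := mG_lt _ _ Ib Ia lt; rewrite ab ltxx.
(* Strictness matters: the ray excludes parameter 1, where the value would be [G2 p]. *)
have [p [Ip ps pt]] : exists p, [/\ I p, p < s & p < t].
  have Im : I (Num.min s t) by rewrite /Num.min; case: ifP.
  have [e e0 Ie] := @open_shift R R^o I (Num.min s t) (-1) oI Im.
  exists (Num.min s t + e *: (-1 : R^o)) => //.
  have : e *: (-1 : R^o) < 0 by rewrite /GRing.scale/= mulrN1 oppr_lt0.
  by split => //; [have : Num.min s t <= s by rewrite ge_min lexx|
                have : Num.min s t <= t by rewrite ge_min lexx orbT]; lra.
have [q [Iq sq tq]] : exists q, [/\ I q, s <= q & t <= q].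
  exists (Num.max s t); rewrite !le_max !lexx orbT; split => //.
  by rewrite /Num.max; case: ifP.
have [w [x [e [cw w1 w0 wray]]]] := concave_with_affine_ray N0 dD.
have Gps := mG_lt _ _ Ip Is ps; have Gpt := mG_lt _ _ Ip It pt.
have Gsq := mG_le _ _ Is Iq sq; have Gtq := mG_le _ _ It Iq tq.
pose c := G2 q - G2 p; have c0 : 0 < c by rewrite /c; lra.
pose u y := G2 p + c * w y.
(* [f] inverts [G2] on the values of [u]; outside [D] its value is arbitrary. *)
have [f fP] : {f : 'rV[R]_N -> R & forall y, D y -> I (f y) /\ G2 (f y) = u y}.
  apply: (@choice _ _ (fun y a => D y -> I a /\ G2 a = u y)) => y.
  have [Dy|nDy] := pselect (D y); last by exists 0.
  have uq : u y <= G2 q by rewrite /u /c; have := w1 _ Dy; nra.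
  (* On the whole space [w] may be negative, so [p] can be too large a lower endpoint. *)
  have [p' Ip' p'u] : exists2 p', I p' & G2 p' <= u y.
    case: w0 => [/unbG|/(_ y Dy) w0]; first exact.
    by exists p => //; rewrite /u lerDl mulr_ge0// ltW.
  have p'q : p' <= q.
    by rewrite leNgt; apply/negP => /(mG_lt _ _ Iq Ip'); lra.
  have [|a Ia aE] := @interval_IVT G2 p' q (u y) cG Ip' Iq p'q.
    by rewrite p'u.
  by exists a.
have If y : D y -> I (f y) by move=> /fP[].
have [_ _ cD] := dD.
have cf : concave_on D (G2 \o f).
  move=> y z m Dy Dz m01 /=.
  rewrite (fP _ Dy).2 (fP _ Dz).2 (fP _ (convex_set_comb cD Dy Dz m01)).2 /u.
  by have := cw _ _ _ Dy Dz m01; nra.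
(* The ray parameter solves [G2 p + c * (1 - t) = G2 a]. It is affine in [G2 a], so [G2]-means
   correspond to convex combinations of points. *)
have ray a : I a -> G2 p < G2 a <= G2 q ->
    D (x + ((G2 q - G2 a) / c) *: e) /\ f (x + ((G2 q - G2 a) / c) *: e) = a.
  move=> Ia pa.
  have [|Da wa] := wray ((G2 q - G2 a) / c).
    by rewrite divr_ge0 ?ltr_pdivrMr//= ?/c; lra.
  split => //; apply: injG => //; first exact: If.
  rewrite (fP _ Da).2 /u wa mulrBr mulr1 mulrCA divff ?gt_eqF// mulr1 /c.
  by ring.
have [Ds fs] := ray s Is (introT andP (conj Gps Gsq)).
have [Dt ft] := ray t It (introT andP (conj Gpt Gtq)).
have [|_ fr] := ray r Ir.
  have m_ge0 : 0 <= 1 - mu by lra.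
  rewrite rE; apply/andP; split; last by nra.
  have [mu0|mu_gt0] := leP mu 0.
    have -> : mu = 0 by lra.
    by lra.
  have : 0 < mu * (G2 t - G2 p) by rewrite mulr_gt0 ?subr_gt0.
  have : 0 <= (1 - mu) * (G2 s - G2 p) by rewrite mulr_ge0// subr_ge0 ltW.
  by lra.
have := sub f If cf _ _ mu Ds Dt mu01; rewrite /= fs ft.
suff -> : (1 - mu) *: (x + ((G2 q - G2 s) / c) *: e) +
    mu *: (x + ((G2 q - G2 t) / c) *: e) = x + ((G2 q - G2 r) / c) *: e.
  by rewrite fr.
by apply/rowP => i; rewrite !mxE rE; field; rewrite gt_eqF.
Qed.

End Transfer.

Lemma affine_of_common_means (R : realType) (I : set R) (G1 G2 : R -> R) :
  {in I &, {homo G1 : s t / s < t}} -> {in I &, {homo G2 : s t / s < t}} ->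
  (forall s t r mu, I s -> I t -> I r -> 0 <= mu <= 1 ->
     G2 r = (1 - mu) * G2 s + mu * G2 t ->
     G1 r = (1 - mu) * G1 s + mu * G1 t) ->
  forall a b, I a -> I b -> a < b ->
  exists A B : R, 0 < A /\ forall t, I t -> G1 t = A * G2 t + B.
Proof.
move=> mG1 mG2 means a b Ia Ib ab.
have m1 s t : I s -> I t -> s < t -> G1 s < G1 t.
  by move=> Is It; apply: mG1; rewrite inE.
have m2 s t : I s -> I t -> s < t -> G2 s < G2 t.
  by move=> Is It; apply: mG2; rewrite inE.
(* The points [(G2, G1)] at three ordered arguments are collinear. *)
have col s r t : I s -> I r -> I t -> s < r -> r < t ->
    (G1 r - G1 s) * (G2 t - G2 s) = (G1 t - G1 s) * (G2 r - G2 s).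
  move=> Is Ir It sr rt.
  have sr2 := m2 _ _ Is Ir sr; have rt2 := m2 _ _ Ir It rt.
  have st2 : 0 < G2 t - G2 s by lra.
  have -> : G1 r = (1 - (G2 r - G2 s) / (G2 t - G2 s)) * G1 s +
                   (G2 r - G2 s) / (G2 t - G2 s) * G1 t.
    apply: means => //; last by field; lra.
    by rewrite divr_ge0 ?ler_pdivrMr//=; lra.
  by field; lra.
have ab1 := m1 _ _ Ia Ib ab; have ab2 := m2 _ _ Ia Ib ab.
pose A := (G1 b - G1 a) / (G2 b - G2 a).
exists A, (G1 a - A * G2 a); split; first by rewrite divr_gt0 ?subr_gt0.
move=> t It.
suff H : (G1 t - G1 a) * (G2 b - G2 a) = (G1 b - G1 a) * (G2 t - G2 a).
  have -> : G1 t = G1 a + (G1 t - G1 a) * (G2 b - G2 a) / (G2 b - G2 a).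
    by field; lra.
  by rewrite H /A; field; lra.
case: (ltgtP t a) => [ta|at_|->]; last by ring.
  by have := col _ _ _ It Ia Ib ta ab; lra.
case: (ltgtP t b) => [tb|bt|->//]; first exact: col.
by have := col _ _ _ Ia Ib It ab bt; lra.
Qed.

(** * Reduction of admissible functions to real-valued ones *)

Section Admissible.
Variables (R : realType) (I : set R) (F : R -> \bar R).
Hypotheses (oI : open I) (aF : admissible I F).

Lemma admissible_fineK (t : R) : I t -> (fine (F t))%:E = F t.
Proof.
move=> It; case: aF => Fy mF _.
(* A smaller point of [I] has a strictly smaller value, which rules out [-oo] at [t]. *)
have [e e0 Ie] := @open_shift R R^o I t (-1) oI It.
have /(mF _ _ Ie It) : t + e *: (-1 : R^o) < t.
  by rewrite /GRing.scale/= mulrN1 gtrDl oppr_lt0.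
by have := Fy _ It; case: (F t) => [r//| //|_]; rewrite ltNge leNye.
Qed.

Lemma admissible_homo : {in I &, {homo fine \o F : s t / s < t}}.
Proof.
move=> s t; rewrite !inE => Is It st; case: aF => _ mF _.
by have := mF _ _ Is It st; rewrite -admissible_fineK// -[F t]admissible_fineK.
Qed.

Lemma admissible_continuous (t : R) :
  I t -> {for t, continuous (fine \o F : R -> R)}.
Proof.
move=> It; case: aF => _ _; move/interior_id : (oI) => -> /(_ t It).
move=> cF; apply: fine_cvg; rewrite (admissible_fineK It).
exact: cF.
Qed.

Lemma F_concaveE (N : nat) (D : set 'rV[R]_N) (f : 'rV[R]_N -> R) :
  convex_set D -> (forall x, D x -> I (f x)) ->
  F_concave D F f <-> concave_on D ((fine \o F) \o f).
Proof.
move=> cD If.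
have E x y mu : D x -> D y -> 0 <= mu <= 1 ->
    ((1 - mu)%R%:E * F (f x) + mu%:E * F (f y)
       <= F (f ((1 - mu) *: x + mu *: y)%R))%E =
    ((1 - mu) * fine (F (f x)) + mu * fine (F (f y)) <=
       fine (F (f ((1 - mu) *: x + mu *: y)))).
  move=> Dx Dy mu01; have Iz := If _ (convex_set_comb cD Dx Dy mu01).
  rewrite -{1}(admissible_fineK (If _ Dx)) -{1}(admissible_fineK (If _ Dy)).
  by rewrite -{1}(admissible_fineK Iz).
by split=> H x y mu Dx Dy mu01; have := H x y mu Dx Dy mu01; rewrite E.
Qed.

(** Constants are always [F]-concave, so nontriviality must come from a nonconstant function. *)
Lemma nontrivial_concavity (N : nat) (D : set 'rV[R]_N) :
  convex_set D -> ~ trivial_concavity D I F ->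
  exists f, F_concave_functions D I F f /\
    exists x y, [/\ D x, D y & f y < f x].
Proof.
move=> cD; apply: contra_notP => nex; apply/seteqP; split => f /=.
  move=> Cf; split; first by case: Cf.
  have [[x Dx]|/forallNP D0] := pselect (exists x, D x); last first.
    by exists 0 => x /D0.
  exists (f x) => y Dy; apply: contra_notP nex => /eqP fyx.
  exists f; split => //; case: (ltgtP (f y) (f x)) fyx => // lt _.
    by exists x, y.
  by exists y, x.
move=> [If [c fc]]; split => //; apply/F_concaveE => // x y mu Dx Dy mu01 /=.
have Dz := convex_set_comb cD Dx Dy mu01.
by rewrite !fc// -mulrDl subrK mul1r.
Qed.

End Admissible.

(** [B] cancels because the weights sum to 1, and scaling by [A > 0] preserves the inequality. *)
Lemma F_concave_functions_affine (R : realType) (N : nat) (D : set 'rV[R]_N)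
    (I : set R) (F1 F2 : R -> \bar R) (A B : R) :
  convex_set D -> open I -> admissible I F1 -> admissible I F2 -> 0 < A ->
  (forall t, I t -> F1 t = (A%:E * F2 t + B%:E)%E) ->
  F_concave_functions D I F1 = F_concave_functions D I F2.
Proof.
move=> cD oI aF1 aF2 A0 F12.
have G12 t : I t -> fine (F1 t) = A * fine (F2 t) + B.
  by move=> It; rewrite F12// -(admissible_fineK oI aF2 It).
apply/seteqP; split => f /= [If Cf]; split => //.
  apply/(F_concaveE oI aF2) => //.
  move/(F_concaveE oI aF1 cD If) : Cf => Cf x y mu Dx Dy mu01.
  have Dz := convex_set_comb cD Dx Dy mu01.
  have := Cf x y mu Dx Dy mu01;
    rewrite /= (G12 _ (If _ Dx)) (G12 _ (If _ Dy)) (G12 _ (If _ Dz)) => H.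
  by rewrite -(ler_pM2l A0); lra.
apply/(F_concaveE oI aF1) => //.
move/(F_concaveE oI aF2 cD If) : Cf => Cf x y mu Dx Dy mu01.
have Dz := convex_set_comb cD Dx Dy mu01.
have := Cf x y mu Dx Dy mu01.
rewrite /= (G12 _ (If _ Dx)) (G12 _ (If _ Dy)) (G12 _ (If _ Dz)).
by rewrite -(ler_pM2l A0); lra.
Qed.

Unset Implicit Arguments.

Theorem theorem1p2 (R : realType) (N : nat) (hN : (1 <= N)%N)
    (Omega : set 'rV[R]_N) (hOmega : convex_domain Omega)
    (I : set R) (hI : nondegenerate_interval I) (hIopen : open I)
    (F1 F2 : R -> \bar R) (hF1 : admissible I F1) (hF2 : admissible I F2)
    (hnontriv : ~ trivial_concavity Omega I F1) :
  F_concave_functions Omega I F1 = F_concave_functions Omega I F2 <->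
  exists A B : R, 0 < A /\
    forall t : R, I t -> F1 t = (A%:E * F2 t + B%:E)%E.
Proof.
have [_ _ cO] := hOmega; have [iI [a0 /interior_subset Ia0]] := hI.
split=> [C12|[A [B [A0 F12]]]]; last exact: F_concave_functions_affine F12.
have [f [Cf1 [x [y [Dx Dy fyx]]]]] := nontrivial_concavity hIopen hF1 cO hnontriv.
(* The same nonconstant [f] makes both functions unbounded below when [Omega] is the whole space. *)
have Cf2 : F_concave_functions Omega I F2 f by rewrite -C12.
have unb F (aF : admissible I F) : F_concave_functions Omega I F f ->
    Omega = setT -> forall M : R, exists2 s, I s & (fine \o F) s <= M.
  move=> [If /(F_concaveE hIopen aF cO If) Cf] OT M; rewrite OT in Cf.
  have [|z zM] := @concave_unbounded_below _ _ _ x y Cf _ M.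
    by apply: (admissible_homo hIopen aF) => //; rewrite inE; exact: If.
  by exists (f z) => //; apply: If; rewrite OT.
have sub Fa Fb (aFa : admissible I Fa) (aFb : admissible I Fb) :
    F_concave_functions Omega I Fa = F_concave_functions Omega I Fb ->
    forall g, (forall z, Omega z -> I (g z)) ->
    concave_on Omega ((fine \o Fa) \o g) -> concave_on Omega ((fine \o Fb) \o g).
  move=> CE g Ig cg; apply/(F_concaveE hIopen aFb cO Ig).
  have : F_concave_functions Omega I Fa g.
    by split => //; apply/(F_concaveE hIopen aFa cO Ig).
  by rewrite CE => -[].
have [e e0 Ie] := @open_shift R R^o I a0 1 hIopen Ia0.
have a0e : a0 < a0 + e *: (1 : R^o) by rewrite /GRing.scale/= mulr1 ltrDl.
have h1 := admissible_homo hIopen hF1; have h2 := admissible_homo hIopen hF2.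
have c1 := @admissible_continuous _ _ _ hIopen hF1.
have c2 := @admissible_continuous _ _ _ hIopen hF2.
have tr21 := concavity_transfer hN hOmega iI hIopen h2 c2 (unb _ hF2 Cf2)
  (sub _ _ hF2 hF1 (esym C12)).
have tr12 := concavity_transfer hN hOmega iI hIopen h1 c1 (unb _ hF1 Cf1)
  (sub _ _ hF1 hF2 C12).
have [|A [B [A0 G12]]] := @affine_of_common_means _ I _ _ h1 h2 _ _ _ Ia0 Ie a0e.
  move=> s t r mu Is It Ir mu01 rE.
  (* [r] is the [F2]-mean of [s] and [t], and [r'] their [F1]-mean; the goal becomes equality of
     their [F1]-values. *)
  have [r' Ir' r'E] : exists2 r', I r' & (fine \o F1) r' =
      (1 - mu) * (fine \o F1) s + mu * (fine \o F1) t.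
    have mid u v m : I u -> I v -> u <= v -> 0 <= m <= 1 ->
        exists2 r', I r' & (fine \o F1) r' =
          (1 - m) * (fine \o F1) u + m * (fine \o F1) v.
      move=> Iu Iv uv m01; apply: (interval_IVT iI c1 Iu Iv uv).
      have : (fine \o F1) u <= (fine \o F1) v.
        by move: uv; rewrite le_eqVlt => /orP[/eqP->//|uv];
          apply/ltW/h1; rewrite ?inE.
      by move=> H; apply/andP; split; nra.
    have [st|/ltW ts] := leP s t; first exact: mid.
    have [|r' Ir' r'E] := mid t s (1 - mu) It Is ts; first by lra.
    by exists r' => //; rewrite r'E; ring.
  (* [tr21] bounds the [F1]-mean by [F1 r]; conversely [tr12] gives [F2 r <= F2 r'], which excludes
     [r' < r]. *)
  apply/eqP; rewrite eq_le tr21// andbT -r'E.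
  have := tr12 s t r' mu Is It Ir' mu01 r'E; rewrite -rE => rr'.
  case: (ltgtP r r') => [lt|lt|->//]; first by apply/ltW/h1; rewrite ?inE.
  by have := h2 r' r; rewrite !inE => /(_ Ir' Ir lt); rewrite ltNge rr'.
exists A, B; split => // t It.
rewrite -(admissible_fineK hIopen hF1 It) -(admissible_fineK hIopen hF2 It).
by have /= -> := G12 t It.
Qed.
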